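(* (Type $q$-P$(A_5)$.) Let $Y(x)={}^t(y_1(x),y_2(x))$ be meromorphic on $\mathbb{C}^*$ and satisfy $Y(qx)=A(x)Y(x)$ with the matrix $A(x)$ of the context, and suppose $\lambda=a_1t$. Then $$y_1(q^2x)-\frac{(qx-a_1t)(q\kappa_1x^2-dx+\theta_1t)}{x-a_1t}y_1(qx)+\kappa_1\kappa_2x(qx-a_1t)(x-a_2t)y_1(x)=0,$$ $$d=q\kappa_1a_1t+\frac{\theta_1}{a_1}-q\kappa_1\kappa_2\mu .$$ Defining $y$ by $y_1(x)=(x/q-a_1t)y(x)$, one has $$y(q^2x)-(q\kappa_1x^2-dx+\theta_1t)y(qx)+\kappa_1\kappa_2x\left(\frac{x}{q}-a_1t\right)(x-a_2t)y(x)=0,$$ and, if $u$ is a meromorphic function on $\mathbb{C}^*$, not identically zero, with $u(qx)=(x/q-a_1t)u(x)$, then $f(x)=y(qx)/u(qx)$ satisfies $$(x-a_1t)f(qx)-(q\kappa_1x^2-dx+\theta_1t)f(x)+\kappa_1\kappa_2x(x-a_2t)f(x/q)=0.$$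
   Context: Let $q,t,\kappa_1,\kappa_2,a_1,a_2,\theta_1,\lambda,\mu,\omega$ be nonzero complex numbers. The matrix is $$A(x)=\begin{pmatrix}\kappa_1\{(x-\lambda)(x-\alpha)+\mu_1\}&\omega(x-\lambda)\\ \kappa_1\omega^{-1}(\gamma x+\delta)&\kappa_2(x-\lambda)+\mu_2\end{pmatrix},$$ $$\mu_1=\frac{(\lambda-a_1t)(\lambda-a_2t)}{q\kappa_1\mu},\quad \mu_2=q\kappa_1\kappa_2\mu\lambda,\quad \alpha=\frac{\lambda^{-1}(\theta_1t-\kappa_1\mu_1-\mu_2)+\kappa_2}{\kappa_1},$$ $$\gamma=\mu_2-\kappa_2\{2\lambda+\alpha-(a_1+a_2)t\},\quad \delta=\lambda^{-1}(\alpha\lambda+\mu_1)(\kappa_2\lambda-\mu_2).$$ (This is the linear system of Murata's Lax form for the $q$-Painlevé equation of type $A_5$; it satisfies $\det A(x)=\kappa_1\kappa_2x(x-a_1t)(x-a_2t)$.) Equations are understood as identities of meromorphic functions. *)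

(* Defs.v *)
From HB Require Import structures.
From mathcomp Require Import all_boot all_order all_algebra.
From mathcomp Require Import complex.
From mathcomp Require Import all_classical all_reals topology normedtype derive.

Set Implicit Arguments.
Unset Strict Implicit.
Unset Printing Implicit Defensive.

Import Order.TTheory GRing.Theory Num.Theory.
Import numFieldNormedType.Exports.

Local Open Scope classical_set_scope.
Local Open Scope ring_scope.

Section Meromorphic.
Variable R : realType.
Local Notation C := R[i].

(* Derivability in the direction 1 over the scalar field C is complex
   differentiability. *)
Definition holomorphic_at (g : C -> C) (a : C) : Prop :=
  \forall z \near (a : C^o), derivable (g : C^o -> C^o) z 1.

(* Meromorphic functions are represented by total functions whose value at a
   single point is irrelevant: f is, in a punctured neighbourhood of a, a
   holomorphic function divided by a power of z - a. *)
Definition meromorphic_at (f : C -> C) (a : C) : Prop :=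
  exists n : nat, exists2 g : C -> C, holomorphic_at g a &
    \forall z \near (a : C^o)^', f z = g z / (z - a) ^+ n.

Definition meromorphic (f : C -> C) : Prop :=
  forall a : C, a != 0 -> meromorphic_at f a.

(* Equality of (scalar- or vector-valued) meromorphic functions on C^*:
   equality outside a subset of C^* without accumulation point in C^*. *)
Definition mero_eq (T : Type) (f g : C -> T) : Prop :=
  forall a : C, a != 0 -> \forall z \near (a : C^o)^', f z = g z.

End Meromorphic.

Section LaxMatrix.
Variable F : fieldType.
Variables q t kappa1 kappa2 a1 a2 theta1 lambda mu omega : F.

Definition mu1 : F :=
  (lambda - a1 * t) * (lambda - a2 * t) / (q * kappa1 * mu).

Definition mu2 : F := q * kappa1 * kappa2 * mu * lambda.

Definition alpha : F :=
  (lambda^-1 * (theta1 * t - kappa1 * mu1 - mu2) + kappa2) / kappa1.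

Definition gamma : F :=
  mu2 - kappa2 * (2 * lambda + alpha - (a1 + a2) * t).

Definition delta : F :=
  lambda^-1 * (alpha * lambda + mu1) * (kappa2 * lambda - mu2).

Definition laxA (x : F) : 'M[F]_2 :=
  \matrix_(i < 2, j < 2)
    if i == 0 then
      if j == 0 then kappa1 * ((x - lambda) * (x - alpha) + mu1)
      else omega * (x - lambda)
    else
      if j == 0 then kappa1 * omega^-1 * (gamma * x + delta)
      else kappa2 * (x - lambda) + mu2.

End LaxMatrix.

Definition col2 (F : fieldType) (y1 y2 : F) : 'cV[F]_2 :=
  \col_(i < 2) if i == 0 then y1 else y2.

(* Main.v *)
Require Import Defs.
From mathcomp Require Import all_boot all_order all_algebra complex reals.
From mathcomp Require Import ring classical_sets filter topology normedtype.

Set Implicit Arguments.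
Unset Strict Implicit.
Unset Printing Implicit Defensive.

Import Order.TTheory GRing.Theory Num.Theory.
Import numFieldNormedType.Exports.

Local Open Scope classical_set_scope.
Local Open Scope ring_scope.

(** Eliminating [y2] from the first-order system gives the second-order equation
for [y1]: at [lambda = a1 t] the factor [x - a1 t] divides the first row of the
matrix, so [omega y2] is rational in [x], [y1 x] and [y1 (q x)].  The other two
equations are this one rescaled by [x / q - a1 t] and by [u].  Each identity holds
wherever finitely many of the assumed relations hold at multiples of [x] and
finitely many points are avoided; since such conditions are stable under
intersection and under scaling of [x], they hold off a set without accumulation
point in C^*. *)

Lemma dnbhs_neq (K : numFieldType) (a b : K) :
  \forall z \near (a : K^o)^', z != b.
Proof.
have [->|ab] := eqVneq a b; first exact: nbhs_dnbhs_neq.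
apply: nbhs_dnbhs; near=> z; rewrite -subr_eq0; near: z.
apply: (@cvgr_neq0 _ K^o _ _ _ (fun z : K^o => z - b : K^o) (a - b)).
  by apply: (@cvgB K K^o); [exact: cvg_id|exact: cvg_cst].
by rewrite subr_eq0.
Unshelve. all: by end_near. Qed.

(** Multiplication by [c] is continuous and, as [c != 0], injective, so near [a] it sends points
    other than [a] to points other than [c * a]. *)
Lemma dnbhs_mull (K : numFieldType) (c a : K) (P : K -> Prop) : c != 0 ->
  (\forall z \near ((c * a : K) : K^o)^', P z) ->
  \forall z \near (a : K^o)^', P (c * z).
Proof.
move=> c0; rewrite /dnbhs !near_withinE => Pca.
near=> z => za.
have : c * z != c * a -> P (c * z).
  by near: z; exact: (@mulrl_continuous K c a _ Pca).
by apply; apply: contra_neq za => /(mulfI c0).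
Unshelve. all: by end_near. Qed.

Lemma mero_eq_mull (R : realType) (T : Type) (f g : R[i] -> T) (c : R[i]) :
  c != 0 -> mero_eq f g -> mero_eq (fun x => f (c * x)) (fun x => g (c * x)).
Proof.
move=> c0 fg a a0.
by apply: (@dnbhs_mull _ c a (fun z => f z = g z)) => //; apply: fg; rewrite mulf_neq0.
Qed.

Lemma laxA_col2 (F : fieldType)
    (q t kappa1 kappa2 a1 a2 theta1 lambda mu omega x v1 v2 w1 w2 : F) :
  col2 w1 w2 =
    laxA q t kappa1 kappa2 a1 a2 theta1 lambda mu omega x *m col2 v1 v2 ->
  w1 = kappa1 * ((x - lambda) * (x - alpha q t kappa1 kappa2 a1 a2 theta1 lambda mu)
         + mu1 q t kappa1 a1 a2 lambda mu) * v1 + omega * (x - lambda) * v2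
  /\ w2 = kappa1 * omega^-1 * (gamma q t kappa1 kappa2 a1 a2 theta1 lambda mu * x
         + delta q t kappa1 kappa2 a1 a2 theta1 lambda mu) * v1
         + (kappa2 * (x - lambda) + mu2 q kappa1 kappa2 lambda mu) * v2.
Proof.
move=> /matrixP E; have := (E 0 0, E 1 0).
by rewrite !mxE !big_ord_recl !big_ord0 !mxE /= !addr0 => -[].
Qed.

(** At [lambda = a1 * t] the term [mu1] vanishes. Eliminating [v2] and [w2] gives [v1] the
    coefficient [det A(x) * (q * x - a1 * t) / (x - a1 * t)], and [det A(x)] is [kappa1 * kappa2 * x
    * (x - a1 * t) * (x - a2 * t)]. *)
Lemma lax_elim (F : fieldType)
    (q t kappa1 kappa2 a1 a2 theta1 mu omega x v1 v2 w1 w2 z1 z2 : F) :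
  q != 0 -> t != 0 -> kappa1 != 0 -> a1 != 0 -> mu != 0 -> omega != 0 ->
  x != a1 * t ->
  let A := laxA q t kappa1 kappa2 a1 a2 theta1 (a1 * t) mu omega in
  let d := q * kappa1 * a1 * t + theta1 / a1 - q * kappa1 * kappa2 * mu in
  col2 w1 w2 = A x *m col2 v1 v2 ->
  col2 z1 z2 = A (q * x) *m col2 w1 w2 ->
  z1 - (q * x - a1 * t) * (q * kappa1 * x ^+ 2 - d * x + theta1 * t)
         / (x - a1 * t) * w1
     + kappa1 * kappa2 * x * (q * x - a1 * t) * (x - a2 * t) * v1 = 0.
Proof.
move=> q0 t0 k0 a0 m0 o0 xa A d /laxA_col2[-> ->] /laxA_col2[-> _].
(* Everything is now linear in the free values [v1] and [v2], and both of their coefficients vanish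
   as rational functions. *)
rewrite /d /delta /gamma /alpha /mu1 /mu2; field.
by rewrite subr_eq0 xa k0 q0 m0 a0 t0 o0.
Qed.

Theorem mainTheorem4 (R : realType)
  (q t kappa1 kappa2 a1 a2 theta1 lambda mu omega : R[i])
  (hq : q != 0) (ht : t != 0) (hkappa1 : kappa1 != 0) (hkappa2 : kappa2 != 0)
  (ha1 : a1 != 0) (ha2 : a2 != 0) (htheta1 : theta1 != 0)
  (hlambda : lambda != 0) (hmu : mu != 0) (homega : omega != 0)
  (y1 y2 : R[i] -> R[i]) (hy1 : meromorphic y1) (hy2 : meromorphic y2)
  (hY : mero_eq (fun x => col2 (y1 (q * x)) (y2 (q * x)))
          (fun x => laxA q t kappa1 kappa2 a1 a2 theta1 lambda mu omega x
                      *m col2 (y1 x) (y2 x)))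
  (hlambda_a1t : lambda = a1 * t) :
  let d := q * kappa1 * a1 * t + theta1 / a1 - q * kappa1 * kappa2 * mu in
  mero_eq
    (fun x => y1 (q ^+ 2 * x)
       - (q * x - a1 * t) * (q * kappa1 * x ^+ 2 - d * x + theta1 * t)
           / (x - a1 * t) * y1 (q * x)
       + kappa1 * kappa2 * x * (q * x - a1 * t) * (x - a2 * t) * y1 x)
    (fun _ => 0)
  /\
  forall y : R[i] -> R[i],
    mero_eq y1 (fun x => (x / q - a1 * t) * y x) ->
    mero_eq
      (fun x => y (q ^+ 2 * x)
         - (q * kappa1 * x ^+ 2 - d * x + theta1 * t) * y (q * x)
         + kappa1 * kappa2 * x * (x / q - a1 * t) * (x - a2 * t) * y x)
      (fun _ => 0)
    /\
    forall u : R[i] -> R[i],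
      meromorphic u -> ~ mero_eq u (fun _ => 0) ->
      mero_eq (fun x => u (q * x)) (fun x => (x / q - a1 * t) * u x) ->
      forall f : R[i] -> R[i],
        mero_eq f (fun x => y (q * x) / u (q * x)) ->
        mero_eq
          (fun x => (x - a1 * t) * f (q * x)
             - (q * kappa1 * x ^+ 2 - d * x + theta1 * t) * f x
             + kappa1 * kappa2 * x * (x - a2 * t) * f (x / q))
          (fun _ => 0).
Proof.
move=> d; subst lambda.
have Ey1 : mero_eq
    (fun x => y1 (q ^+ 2 * x)
       - (q * x - a1 * t) * (q * kappa1 * x ^+ 2 - d * x + theta1 * t)
           / (x - a1 * t) * y1 (q * x)
       + kappa1 * kappa2 * x * (q * x - a1 * t) * (x - a2 * t) * y1 x)
    (fun _ => 0).
  move=> a a0; near=> x.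
  have xa : x != a1 * t by near: x; exact: dnbhs_neq.
  (* Reading [q ^+ 2 * x] as [q * (q * x)] makes the second step the same system taken at
     [q * x]. *)
  rewrite expr2 -mulrA.
  apply: (@lax_elim _ q t kappa1 kappa2 a1 a2 theta1 mu omega x
            (y1 x) (y2 x) (y1 (q * x)) (y2 (q * x)) _ (y2 (q * (q * x)))) => //.
    by near: x; exact: hY.
  by near: x; exact: (mero_eq_mull hq hY).
split=> // y hy.
have Ey : mero_eq
      (fun x => y (q ^+ 2 * x)
         - (q * kappa1 * x ^+ 2 - d * x + theta1 * t) * y (q * x)
         + kappa1 * kappa2 * x * (x / q - a1 * t) * (x - a2 * t) * y x)
      (fun _ => 0).
  move=> a a0; near=> x.
  have xa : x - a1 * t != 0 by rewrite subr_eq0; near: x; exact: dnbhs_neq.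
  have qxa : q * x - a1 * t != 0.
    by rewrite subr_eq0; near: x; apply: (@dnbhs_mull _ q _ (fun z => z != _)) => //;
    exact: dnbhs_neq.
  have e0 : y1 x = (x / q - a1 * t) * y x by near: x; exact: hy.
  (* The shift turns the factor into [x - a1 * t], which cancels the denominator of the middle
     coefficient. *)
  have e1 : y1 (q * x) = (x - a1 * t) * y (q * x).
    have -> : x - a1 * t = q * x / q - a1 * t by rewrite mulrAC mulfV ?mul1r.
    by near: x; exact: (mero_eq_mull hq hy).
  have e2 : y1 (q ^+ 2 * x) = (q * x - a1 * t) * y (q ^+ 2 * x).
    have -> : q * x - a1 * t = q ^+ 2 * x / q - a1 * t by field.
    by near: x; exact: (mero_eq_mull (expf_neq0 2 hq) hy).
  have : y1 (q ^+ 2 * x)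
       - (q * x - a1 * t) * (q * kappa1 * x ^+ 2 - d * x + theta1 * t)
           / (x - a1 * t) * y1 (q * x)
       + kappa1 * kappa2 * x * (q * x - a1 * t) * (x - a2 * t) * y1 x = 0.
    by near: x; exact: Ey1.
  (* All three terms now share the factor [q * x - a1 * t], nonzero off one point. *)
  rewrite e0 e1 e2 => E; apply: (mulfI qxa); rewrite mulr0 -[RHS]E.
  by field; rewrite hq xa.
split=> // u _ _ hu f hf a a0; near=> x.
have xaq : x - a1 * t * q != 0 by rewrite subr_eq0; near: x; exact: dnbhs_neq.
have xqa : x / q - a1 * t != 0.
  have -> : x / q - a1 * t = (x - a1 * t * q) / q by field.
  by rewrite mulf_neq0 ?invr_neq0.
have u1 : u (q * x) = (x / q - a1 * t) * u x by near: x; exact: hu.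
have u2 : u (q * (q * x)) = (x - a1 * t) * u (q * x).
  have -> : x - a1 * t = q * x / q - a1 * t by rewrite mulrAC mulfV ?mul1r.
  by near: x; exact: (mero_eq_mull hq hu).
have f0 : f x = y (q * x) / u (q * x) by near: x; exact: hf.
have f1 : f (q * x) = y (q * (q * x)) / u (q * (q * x)).
  by near: x; exact: (mero_eq_mull hq hf).
have f2 : f (x / q) = y x / u x.
  (* The relation defining [f] is used at [q^-1 * x], so [x] is written as [q * (q^-1 * x)] on the
     right only. *)
  rewrite -{2 3}(mulVKf hq x) [x / q]mulrC.
  by near: x; exact: (mero_eq_mull (invr_neq0 hq) hf).
have xa : x - a1 * t != 0 by rewrite subr_eq0; near: x; exact: dnbhs_neq.
have E : y (q ^+ 2 * x)
         - (q * kappa1 * x ^+ 2 - d * x + theta1 * t) * y (q * x)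
         + kappa1 * kappa2 * x * (x / q - a1 * t) * (x - a2 * t) * y x = 0.
  by near: x; exact: Ey.
rewrite f0 f1 f2 u2 u1.
(* Where [u] vanishes, all three values of [f] are the junk value [_ / 0 = 0]. *)
have [->|ux] := eqVneq (u x) 0; first by rewrite !mulr0 invr0 !mulr0 subr0 addr0.
move: E; rewrite expr2 -mulrA => E.
(* The multiplier is [u (q * x)], written through [u x]; the factor [x - a1 * t] in front of
   [f (q * x)] cancels the one from [u2], which leaves [E]. *)
apply: (mulfI (mulf_neq0 xqa ux)); rewrite mulr0 -[RHS]E; field.
by rewrite hq ux xa mulNr xaq.
Unshelve. all: by end_near. Qed.
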